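(* Let $R$ be a commutative ring with identity, $S$ a multiplicatively closed subset of $R$, $M$ an $R$-module, and $P$ a submodule of $M$ with $(P:_R M)\cap S=\emptyset$. Then $P$ is an $S$-primary submodule of $M$ if and only if $(P:_M s)$ is a primary submodule of $M$ for some $s\in S$.
   Context: All rings are commutative with identity and all modules are unital. A multiplicatively closed subset $S$ of $R$ is a non-empty subset with $0\notin S$, $1\in S$, and $ss'\in S$ for all $s,s'\in S$. $(P:_R M)=\{r\in R : rM\subseteq P\}$, $(P:_M s)=\{m\in M : sm\in P\}$, and $\sqrt{I}$ is the radical of an ideal $I$. A submodule $P$ of $M$ with $(P:_R M)\cap S=\emptyset$ is called $S$-primary if there exists $s\in S$ such that whenever $rm\in P$ with $r\in R$, $m\in M$, then $sr\in\sqrt{(P:_R M)}$ or $sm\in P$. A submodule $P$ of $M$ is primary if $P\ne M$ and whenever $rm\in P$ with $r\in R$, $m\in M$, then $r\in\sqrt{(P:_R M)}$ or $m\in P$. *)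

(* Defs.v *)
From HB Require Import structures.
From mathcomp Require Import all_boot all_algebra.
From mathcomp Require Import boolp classical_sets.

Set Implicit Arguments.
Unset Strict Implicit.
Unset Printing Implicit Defensive.

Import GRing.Theory.
Local Open Scope classical_set_scope.
Local Open Scope ring_scope.

Definition mult_closed_subset (R : comPzRingType) (S : set R) : Prop :=
  [/\ S !=set0, ~ S 0, S 1 & forall s t, S s -> S t -> S (s * t)].

(* [in P] is the boolean (classical) membership predicate of the set P. *)
Definition is_submodule (R : comPzRingType) (M : lmodType R) (P : set M) : Prop :=
  GRing.submod_closed [in P].

(* The residual (P :_R M). *)
Definition colon_ring (R : comPzRingType) (M : lmodType R) (P : set M) : set R :=
  [set r | forall m : M, P (r *: m)].

(* The residual (P :_M s). *)
Definition colon_module (R : comPzRingType) (M : lmodType R) (P : set M) (s : R) :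
  set M := [set m | P (s *: m)].

(* Exponents are positive; for an ideal I, allowing exponent 0 would give the
   same set. *)
Definition radical (R : comPzRingType) (I : set R) : set R :=
  [set r | exists n : nat, I (r ^+ n.+1)].

Definition S_primary (R : comPzRingType) (S : set R) (M : lmodType R)
    (P : set M) : Prop :=
  [/\ is_submodule P,
      colon_ring P `&` S = set0
    & exists2 s, S s & forall (r : R) (m : M), P (r *: m) ->
        radical (colon_ring P) (s * r) \/ P (s *: m)].

Definition primary (R : comPzRingType) (M : lmodType R) (P : set M) : Prop :=
  [/\ is_submodule P,
      P <> setT
    & forall (r : R) (m : M), P (r *: m) ->
        radical (colon_ring P) r \/ P m].

(* Main.v *)
(* If [P] is S-primary with witness [s], then [t m \in P] with [t \in S] forces
   [s m \in P], as [s t] is not in the radical of [(P : M)].  Elements of [S] can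
   thus be cancelled into [s], and [(P : s)] itself is primary.  Conversely, if
   [(P : s)] is primary then [s] is a witness, since [s r^n M \subseteq P] implies
   [(s r)^n M \subseteq P] for [n > 0]. *)

Require Import Defs.
From HB Require Import structures.
From mathcomp Require Import all_boot all_algebra.
From mathcomp Require Import boolp classical_sets.

Set Implicit Arguments.
Unset Strict Implicit.
Unset Printing Implicit Defensive.

Import GRing.Theory.
Local Open Scope classical_set_scope.
Local Open Scope ring_scope.

Lemma submoduleZ (R : comPzRingType) (M : lmodType R) (P : set M) (a : R) (m : M) :
  is_submodule P -> P m -> P (a *: m).
Proof.
(* Closure is given for [a *: u + v]; scaling is the case [v = 0]. *)
move=> [P0 PZD] Pm; have := PZD a m 0.
by rewrite addr0 !unfold_in !in_setE; apply=> //; rewrite -in_setE.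
Qed.

Lemma is_submodule_colon_module (R : comPzRingType) (M : lmodType R) (P : set M)
    (s : R) : is_submodule P -> is_submodule (colon_module P s).
Proof.
move=> [P0 PZD]; split.
  by rewrite unfold_in in_setE /colon_module /= scaler0 -in_setE.
move=> a u v; rewrite !unfold_in !in_setE /colon_module /= => Pu Pv.
rewrite scalerDr scalerA mulrC -scalerA -in_setE.
by apply: PZD; rewrite unfold_in in_setE.
Qed.

Lemma mult_closed_subsetX (R : comPzRingType) (S : set R) (s : R) (n : nat) :
  mult_closed_subset S -> S s -> S (s ^+ n).
Proof.
move=> [_ _ S1 SM] Ss; elim: n => [|n IHn]; first by rewrite expr0.
by rewrite exprS; apply: SM.
Qed.

Theorem theorem2p24 (R : comPzRingType) (S : set R) (M : lmodType R) (P : set M)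
    (hS : mult_closed_subset S) (hP : is_submodule P)
    (hPS : colon_ring P `&` S = set0) :
  S_primary S P <-> exists2 s : R, S s & primary (colon_module P s).
Proof.
split.
- move=> [_ _ [s Ss sP]]; exists s => //.
  have notPS t : S t -> ~ colon_ring P t.
    by move=> St Pt; have : (colon_ring P `&` S) t by []; rewrite hPS.
  have SM t u : S t -> S u -> S (t * u) by case: hS => _ _ _; apply.
  have cancelS t m : S t -> P (t *: m) -> P (s *: m).
    move=> St /sP[[n Pn]|//]; case: (notPS ((s * t) ^+ n.+1)) => //.
    by apply: mult_closed_subsetX => //; apply: SM.
  split; first exact: is_submodule_colon_module.
    (* If [(P : s)] were all of [M], then [s] would lie in [(P : M)]. *)
    move=> PT; apply: (notPS s) => // m.
    by have : colon_module P s m by rewrite PT.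
  (* The S-primary condition is applied to [r] and [s *: m]. The surplus factor, [s ^+ n.+1] or
     [s * s], is then cancelled into a single [s]. *)
  move=> r m; rewrite /colon_module /= scalerA mulrC -scalerA => /sP[[n Pn]|Pssm].
    left; exists n => m' /=; apply: (cancelS (s ^+ n.+1)).
      exact: mult_closed_subsetX.
    by rewrite scalerA -exprMn; apply: Pn.
  by right; apply: (cancelS (s * s)); [apply: SM | rewrite -scalerA].
- move=> [s Ss [_ _ sP]]; split=> //; exists s => // r m Prm.
  (* [P] is contained in [(P : s)], so primarity applies to [r *: m]. *)
  have /sP[[n Pn]|] : colon_module P s (r *: m) by exact: submoduleZ hP Prm.
    left; exists n => m'.
    (* The positive exponent leaves one [s] to pair with [r ^+ n.+1]:
       [(s r)^(n+1) = s^n (s r^(n+1))]. *)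
    rewrite exprMn exprSr -mulrA -!scalerA.
    by apply: submoduleZ => //; apply: Pn.
  by right.
Qed.
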